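(* Let $V$ be a locally linearly compact vector space over a discrete field $\mathbb K$, let $\phi\colon V\to V$ be a continuous endomorphism and let $U\in\mathcal B(V)$. For every positive integer $n$ let $$\alpha_n=\dim\frac{T_{n+1}(\phi,U)}{T_n(\phi,U)}.$$ Then the sequence of non-negative integers $\{\alpha_n\}_n$ is stationary (eventually constant), and $H(\phi,U)=\alpha$, where $\alpha$ is the value of $\alpha_n$ for all sufficiently large $n$; that is, the limit $\lim_{n\to\infty}\frac1n\dim\frac{T_n(\phi,U)}{U}$ defining $H(\phi,U)$ exists and equals $\alpha$.
   Context: $\mathbb K$ is an arbitrary field endowed with the discrete topology. A topological vector space over $\mathbb K$ is linearly topologized if it is Hausdorff and has a neighborhood basis at $0$ consisting of linear subspaces. A linear variety of $V$ is a coset $v+W$ of a linear subspace $W$; it is closed (open) if $W$ is closed (open). A linearly topologized vector space is linearly compact if every collection of closed linear varieties with the finite intersection property has non-empty intersection. A linearly topologized vector space is locally linearly compact (l.l.c.) if it has an open linear subspace that is linearly compact; $\mathcal B(V)$ denotes the family of all linearly compact open linear subspaces of $V$. ''Endomorphism'' means linear endomorphism. For $U\in\mathcal B(V)$ and a positive integer $n$, $T_n(\phi,U)=U+\phi U+\dots+\phi^{n-1}U$; one has $T_n(\phi,U)\in\mathcal B(V)$ and $T_n(\phi,U)\leq T_{n+1}(\phi,U)$. The algebraic entropy of $\phi$ with respect to $U$ is $H(\phi,U)=\lim_{n\to\infty}\frac1n\dim\frac{T_n(\phi,U)}{U}$. *)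

(* Defs.v *)
From HB Require Import structures.
From mathcomp Require Import all_boot all_order all_algebra.
From mathcomp Require Import all_classical all_reals ereal topology.
From mathcomp Require Import num_normedtype pseudometric_normed_Zmodule.

Set Implicit Arguments.
Unset Strict Implicit.
Unset Printing Implicit Defensive.

Import Order.TTheory GRing.Theory Num.Theory.
Import numFieldTopology.Exports.

Local Open Scope classical_set_scope.
Local Open Scope ring_scope.

(* The topological modules of [normedtype_theory/tvs.v] only allow scalars in a
   [numDomainType] with their norm topology, whereas here the scalars form an
   arbitrary field with the discrete topology. That file must not be loaded
   when this structure is declared: HB would require the structure to coerce to
   [NbhsLmodule], which is specific to [numDomainType]. *)
HB.mixin Record isDiscreteTvs (K : fieldType) V
    & PreTopologicalZmodule V & GRing.Lmodule K V := {
  dtvs_add_continuous : continuous (fun z : V * V => z.1 + z.2);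
  dtvs_scale_continuous :
    continuous (fun z : discrete_topology K * V => (z.1 : K) *: z.2)
}.

#[short(type="discreteTvsType")]
HB.structure Definition DiscreteTvs (K : fieldType) :=
  {V of PreTopologicalZmodule V & GRing.Lmodule K V & isDiscreteTvs K V}.

Section LinearlyCompact.
Context {K : fieldType} {V : discreteTvsType K}.
Implicit Types (A B S U W : set V) (v : V).

Definition linear_subspace W : Prop := submod_closed (mem W).

Definition coset v W : set V := [set v + w | w in W].

(* [closed (S : set (subspace W))] is closedness of [S] in the topology
   induced on [W]. *)
Definition closed_linear_variety_in W A : Prop :=
  exists v S, [/\ W v, linear_subspace S, S `<=` W,
    closed (S : set (subspace W)) & A = coset v S].

Definition linearly_compact W : Prop :=
  forall F : set (set V), F `<=` closed_linear_variety_in W ->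
    finI F id -> \bigcap_(A in F) A !=set0.

(* The family of linearly compact open linear subspaces. *)
Definition lc_open_subspaces : set (set V) :=
  [set U | [/\ linear_subspace U, open U & linearly_compact U]].

End LinearlyCompact.

Definition linearly_topologized (K : fieldType) (V : discreteTvsType K) : Prop :=
  hausdorff_space V /\
  forall N : set V, nbhs 0 N ->
    exists2 W, linear_subspace W & nbhs 0 W /\ W `<=` N.

Definition locally_linearly_compact (K : fieldType) (V : discreteTvsType K) :
    Prop :=
  linearly_topologized V /\ exists U : set V, lc_open_subspaces U.

Section Entropy.
Context (R : realType) {K : fieldType} {V : discreteTvsType K}.
Implicit Types (A B U : set V) (phi : {linear V -> V}).

(* The cosets [e i + B], [i < n], form a basis of [A / B]; recall that
   [\sum_i c i *: (e i + B)] is the coset of [\sum_i c i *: e i]. *)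
Definition quotient_basis A B n (e : 'I_n -> V) : Prop :=
  (forall i, A (e i)) /\
  forall x, A x -> exists! c : {ffun 'I_n -> K},
    coset x B = coset (\sum_(i < n) c i *: e i) B.

(* The dimension of [A / B] for linear subspaces [B `<=` A]: all finite bases
   have the same number of elements, and the value is [+oo] if there is none. *)
Definition quotient_dim A B : \bar R :=
  ereal_inf [set n%:R%:E | n in
    [set n : nat | exists e : 'I_n -> V, quotient_basis A B e]].

(* [U + phi U + ... + phi ^ (n - 1) U]. *)
Definition trajectory phi U (n : nat) : set V :=
  [set \sum_(i < n) iter i phi (u i) | u in
    [set u : 'I_n -> V | forall i, U (u i)]].

(* The term at [n = 0] is irrelevant: it does not affect the limit. *)
Definition entropy_seq phi U (n : nat) : \bar R :=
  ((n%:R^-1 : R)%:E * quotient_dim (trajectory phi U n) U)%E.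

Definition algebraic_entropy phi U : \bar R :=
  limn (entropy_seq phi U).

End Entropy.

(* Main.v *)
(* Put [T n = U + phi U + ... + phi^(n-1) U], so that [T (n+1) = U + phi (T n)].
   Hence [phi] induces a surjection of [T (n+1) / T n] onto [T (n+2) / T (n+1)],
   and the dimensions of these quotients are nonincreasing as soon as the first
   one, [T 2 / T 1], is finite-dimensional. The latter is the image under [phi]
   of [U / (U \cap phi^-1 U)], the quotient of a linearly compact space by an
   open subspace, which is finite-dimensional. Finally [dim (T n / U)] is the
   sum of the [alpha i], [0 < i < n], so its mean tends to the eventual value
   of [alpha]. *)

Require Import Defs.
From HB Require Import structures.
From mathcomp Require Import all_boot all_order all_algebra.
From mathcomp Require Import all_classical all_reals ereal topology.
From mathcomp Require Import num_normedtype pseudometric_normed_Zmodule.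
From mathcomp Require Import normedtype sequences.

Set Implicit Arguments.
Unset Strict Implicit.
Unset Printing Implicit Defensive.

Import Order.TTheory GRing.Theory Num.Theory.
Import numFieldTopology.Exports numFieldNormedType.Exports.

Local Open Scope classical_set_scope.
Local Open Scope ring_scope.

(** * Linear subspaces and their cosets *)

Section LinearSubspace.
Context {K : fieldType} {V : discreteTvsType K}.
Implicit Types (A B C W : set V).

Lemma linear_subspaceP W :
  W 0 -> (forall a x y, W x -> W y -> W (a *: x + y)) -> linear_subspace W.
Proof.
move=> W0 WL; split=> [|a x y]; first exact/mem_set.
by move=> /set_mem Wx /set_mem Wy; apply/mem_set; exact: WL.
Qed.

Lemma subspace0 W : linear_subspace W -> W 0.
Proof. by case=> /set_mem. Qed.

Lemma subspaceZD W a x y : linear_subspace W -> W x -> W y -> W (a *: x + y).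
Proof. by case=> _ WL Wx Wy; apply/set_mem/WL; exact/mem_set. Qed.

Lemma subspaceD W x y : linear_subspace W -> W x -> W y -> W (x + y).
Proof. by move=> lW Wx Wy; rewrite -[x]scale1r; exact: subspaceZD. Qed.

Lemma subspaceZ W a x : linear_subspace W -> W x -> W (a *: x).
Proof.
by move=> lW Wx; rewrite -[_ *: _]addr0; apply: subspaceZD => //; exact: subspace0.
Qed.

Lemma subspaceN W x : linear_subspace W -> W x -> W (- x).
Proof. by move=> lW Wx; rewrite -scaleN1r; exact: subspaceZ. Qed.

Lemma subspaceB W x y : linear_subspace W -> W x -> W y -> W (x - y).
Proof. by move=> lW Wx Wy; apply: subspaceD => //; exact: subspaceN. Qed.

Lemma subspace_sum W (I : Type) (r : seq I) (P : pred I) (f : I -> V) :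
  linear_subspace W -> (forall i, P i -> W (f i)) ->
  W (\sum_(i <- r | P i) f i).
Proof.
move=> lW Wf; apply: (big_ind W) => //; first exact: subspace0.
by move=> x y; exact: subspaceD.
Qed.

Lemma eq_cosetP W x y :
  linear_subspace W -> coset x W = coset y W <-> W (x - y).
Proof.
move=> lW; split=> [xy|Wxy].
  have : coset x W x by exists 0; [exact: subspace0|rewrite addr0].
  by rewrite xy => -[w Ww <-]; rewrite addrC addKr.
apply/seteqP; split=> _ [w Ww <-].
  by exists (x - y + w); [exact: subspaceD|rewrite addrA subrKC].
exists (w - (x - y)); first exact: subspaceB.
by rewrite addrCA subKr addrC.
Qed.

Lemma preimage_subspace (phi : {linear V -> V}) W :
  linear_subspace W -> linear_subspace (phi @^-1` W).
Proof.
move=> lW; apply: linear_subspaceP => [|a x y Wx Wy] /=.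
  by rewrite linear0; exact: subspace0.
by rewrite linearP; exact: subspaceZD.
Qed.

Lemma setI_subspace A B :
  linear_subspace A -> linear_subspace B -> linear_subspace (A `&` B).
Proof.
move=> lA lB; apply: linear_subspaceP; first by split; exact: subspace0.
by move=> a x y [? ?] [? ?]; split; exact: subspaceZD.
Qed.

End LinearSubspace.

(** * Linear algebra modulo a subspace, without forming quotient spaces *)

Section QuotientDimension.
Context {K : fieldType} {V : discreteTvsType K}.
Implicit Types (A B C : set V).

Definition quotient_spanning A B n (e : 'I_n -> V) : Prop :=
  (forall i, A (e i)) /\
  forall x, A x -> exists c : 'I_n -> K, B (x - \sum_(i < n) c i *: e i).

Definition quotient_free B n (e : 'I_n -> V) : Prop :=
  forall c : 'I_n -> K, B (\sum_(i < n) c i *: e i) -> forall i, c i = 0.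

(** Uniqueness of the coordinates of 0 is freeness; conversely the difference of two expansions of
    [x] is a combination lying in [B], which freeness makes trivial. *)
Lemma quotient_basisP A B n (e : 'I_n -> V) :
  linear_subspace A -> linear_subspace B ->
  quotient_basis A B e <-> quotient_spanning A B e /\ quotient_free B e.
Proof.
move=> lA lB; split=> [[Ae he]|[[Ae se] fe]].
  split.
    split=> // x /he[c [hc _]]; exists c.
    exact/eq_cosetP.
  move=> c Bc i; have [d [_ ud]] := he 0 (subspace0 lA).
  have h0 : d = [ffun=> 0].
    apply: ud; rewrite big1 // => j _; by rewrite ffunE scale0r.
  have hc : d = [ffun j => c j].
    apply: ud; apply/eq_cosetP => //; rewrite sub0r; apply: subspaceN => //.
    by under eq_bigr do rewrite ffunE.
  by have /ffunP/(_ i) := hc; rewrite h0 !ffunE => <-.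
split=> // x /se[c Bc]; exists [ffun i => c i]; split.
  apply/eq_cosetP => //; by under eq_bigr do rewrite ffunE.
move=> d /eq_cosetP-/(_ lB) Bd; apply/ffunP => i; rewrite ffunE; move: i.
suff h0 : forall i, c i - d i = 0 by move=> i; apply/subr0_eq.
apply: (fe (fun i => c i - d i)).
under eq_bigr do rewrite scalerBl.
rewrite sumrB -[X in B X](subrKA x); apply: subspaceD => //.
by rewrite -opprB; exact: subspaceN.
Qed.

(** The matrix [P] of coordinates of the [f j] along the [e i] has trivial left kernel: a relation
    between its rows gives a combination of the [f j] lying in [B]. So its [m] rows are independent
    in dimension [n]. *)
Lemma quotient_free_leq A B n m (e : 'I_n -> V) (f : 'I_m -> V) :
  linear_subspace B -> quotient_spanning A B e ->
  (forall j, A (f j)) -> quotient_free B f -> (m <= n)%N.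
Proof.
move=> lB [_ se] Af ff.
have /choice[M hM] : forall j, exists c : 'I_n -> K,
  B (f j - \sum_(i < n) c i *: e i) by move=> j; exact: se.
pose P : 'M[K]_(m, n) := \matrix_(j, i) M j i.
suff /eqP <- : row_free P by exact: rank_leq_col.
apply: inj_row_free => v vP; apply/rowP => j; rewrite mxE.
move: j; apply: ff.
(* The subtracted terms add up to the combination of the [e i] with coefficients [v *m P], which is
   0. *)
have -> : \sum_(j < m) v 0 j *: f j =
    \sum_(j < m) v 0 j *: (f j - \sum_(i < n) M j i *: e i).
  under [RHS]eq_bigr do rewrite scalerBr.
  rewrite sumrB [X in _ - X](_ : _ = 0) ?subr0 //.
  under eq_bigr do rewrite scaler_sumr.
  rewrite exchange_big big1 //= => i _.
  have /rowP/(_ i) := vP; rewrite !mxE => vPi.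
  rewrite -[RHS](scale0r (e i)) -vPi scaler_suml.
  by apply: eq_bigr => j _; rewrite mxE scalerA.
by apply: subspace_sum => // j _; exact: subspaceZ.
Qed.

Lemma quotient_dim_basis (R : realType) A B n (e : 'I_n -> V) :
  linear_subspace A -> linear_subspace B ->
  quotient_basis A B e -> quotient_dim R A B = n%:R%:E.
Proof.
move=> lA lB be; rewrite /quotient_dim.
rewrite [X in ereal_inf X](_ : _ = [set n%:R%:E]); first by rewrite ereal_inf1.
have [se fe] := (quotient_basisP e lA lB).1 be.
apply/seteqP; split=> [_ [m [f bf] <-]|_ ->]; last by exists n => //; exists e.
have [sf ff] := (quotient_basisP f lA lB).1 bf.
congr (_%:R%:E); apply/eqP; rewrite eqn_leq.
by rewrite (quotient_free_leq lB se sf.1 ff) (quotient_free_leq lB sf se.1 fe).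
Qed.

(** As long as the family is not free, a vector with a nonzero coefficient in some relation can be
    discarded. *)
Lemma quotient_basis_of_spanning A B n (e : 'I_n -> V) :
  linear_subspace A -> linear_subspace B -> quotient_spanning A B e ->
  exists2 m, (m <= n)%N & exists f : 'I_m -> V, quotient_basis A B f.
Proof.
move=> lA lB; elim: n e => [|n IHn] e [Ae se].
  by exists 0 => //; exists e; apply/quotient_basisP => //; split=> // c _ [].
have [fe|] := pselect (quotient_free B e).
  by exists n.+1 => //; exists e; apply/quotient_basisP.
move=> /existsNP[c /not_implyP[Bc /existsNP[j /eqP cj0]]].
have [|m mn [f bf]] := IHn (fun i => e (lift j i)).
  split=> // x /se[d Bd].
  (* Subtracting [t] times the relation [c] cancels the coefficient of [e j]. *)
  pose t := d j / c j.
  exists (fun i => d (lift j i) - t * c (lift j i)).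
  have := subspaceZD t lB Bc Bd; congr (B _).
  have -> : \sum_(i < n) (d (lift j i) - t * c (lift j i)) *: e (lift j i) =
      \sum_(i < n.+1) (d i - t * c i) *: e i.
    by rewrite [RHS](bigD1_ord j) //= divfK // subrr scale0r add0r.
  under [in RHS]eq_bigr do rewrite scalerBl -scalerA.
  by rewrite sumrB -scaler_sumr opprB addrCA.
by exists m; [exact: leqW|exists f].
Qed.

Lemma quotient_basis_cat A B C m n (e : 'I_m -> V) (f : 'I_n -> V) :
  linear_subspace A -> linear_subspace B -> linear_subspace C ->
  B `<=` A -> C `<=` B ->
  quotient_basis B C e -> quotient_basis A B f ->
  exists g : 'I_(m + n) -> V, quotient_basis A C g.
Proof.
move=> lA lB lC BA CB /quotient_basisP-/(_ lB lC)[[Be se] fe].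
move=> /quotient_basisP-/(_ lA lB)[[Af sf] ff].
pose glue T (a : 'I_m -> T) (b : 'I_n -> T) i :=
  match fintype.split i with inl i => a i | inr i => b i end.
have gluel T a b i : @glue T a b (lshift n i) = a i.
  by rewrite /glue; have /= -> := unsplitK (inl i : 'I_m + 'I_n).
have gluer T a b i : @glue T a b (rshift m i) = b i.
  by rewrite /glue; have /= -> := unsplitK (inr i : 'I_m + 'I_n).
exists (glue _ e f); apply/quotient_basisP => //; split; [split|].
- by move=> i; rewrite /glue; case: fintype.splitP => j _; [exact/BA|].
- move=> x Ax; have [d Bd] := sf x Ax; have [c Cc] := se _ Bd.
  exists (glue _ c d); rewrite big_split_ord /=.
  under eq_bigr do rewrite !gluel.
  under [X in _ - (_ + X)]eq_bigr do rewrite !gluer.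
  by rewrite opprD addrA addrAC.
- move=> c; rewrite big_split_ord /=.
  under eq_bigr do rewrite !gluel.
  under [X in _ + X]eq_bigr do rewrite !gluer.
  move=> Cc.
  (* The [e] part lies in [B], hence so does the [f] part; its coefficients vanish first, which
     leaves a relation between the [e i] modulo [C]. *)
  have d0 : forall i, c (rshift m i) = 0.
    apply: (ff (fun i => c (rshift m i))).
    rewrite -[X in B X](addKr (\sum_(i < m) c (lshift n i) *: e i)) addrC.
    apply: subspaceB => //; first exact: CB.
    by apply: subspace_sum => // i _; exact: subspaceZ.
  have c0 : forall i, c (lshift n i) = 0.
    apply: (fe (fun i => c (lshift n i))); move: Cc.
    by rewrite [X in _ + X]big1 ?addr0 // => i _; rewrite d0 scale0r.
  by move=> i; rewrite -(splitK i); case: fintype.split.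
Qed.

End QuotientDimension.

(** * Finite dimension of a linearly compact space modulo an open subspace *)

Section FiniteDimensionModOpen.
Context {K : fieldType} {V : discreteTvsType K}.
Implicit Types (A B S U W : set V).

Lemma subrr_continuous_at (x : V) : y - x @[y --> x] --> (0 : V).
Proof.
rewrite -(subrr x).
have h : (y, - x) @[y --> x] --> (x, - x).
  by apply: cvg_pair; [exact: cvg_id|exact: cvg_cst].
exact: cvg_comp h (dtvs_add_continuous (x, - x)).
Qed.

(** The complement of [S] contains, with each point [x], the whole coset of [x], a neighbourhood of
    [x] by continuity of translations. *)
Lemma closed_of_nbhs0_subspace S :
  linear_subspace S -> nbhs (0 : V) S -> closed S.
Proof.
move=> lS S0; rewrite -openC openE => x nSx.
have xS : nbhs x ((fun y => y - x) @^-1` S) := @subrr_continuous_at x S S0.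
change (nbhs x (~` S)); apply: filterS xS => y /= Syx Sy.
by apply: nSx; rewrite -(subKr y x); exact: subspaceB.
Qed.

(** Polynomials serve only as finitely supported sequences of coefficients. *)
Definition poly_comb (e : nat -> V) (p : {poly K}) : V :=
  \sum_(i < size p) p`_i *: e i.

Lemma poly_combE e n (p : {poly K}) :
  (size p <= n)%N -> poly_comb e p = \sum_(i < n) p`_i *: e i.
Proof.
move=> pn; rewrite /poly_comb.
rewrite (big_ord_widen n (fun i => p`_i *: e i)) // big_mkcond /=.
apply: eq_bigr => i _; case: ltnP => // /(nth_default 0) ->.
by rewrite scale0r.
Qed.

Lemma poly_combP e a (p q : {poly K}) :
  poly_comb e (a *: p + q) = a *: poly_comb e p + poly_comb e q.
Proof.
pose n := maxn (size p) (size q).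
have pn : (size p <= n)%N by exact: leq_maxl.
have qn : (size q <= n)%N by exact: leq_maxr.
have pqn : (size (a *: p + q)%R <= n)%N.
  by rewrite (leq_trans (size_polyD _ _))// geq_max qn (leq_trans (size_scale_leq _ _)).
rewrite !(@poly_combE _ n) // scaler_sumr -big_split /=.
by apply: eq_bigr => i _; rewrite coefD coefZ scalerDl scalerA.
Qed.

Lemma poly_combB e p q : poly_comb e (p - q) = poly_comb e p - poly_comb e q.
Proof. by rewrite addrC -scaleN1r poly_combP scaleN1r addrC. Qed.

Lemma poly_comb0 e : poly_comb e 0 = 0.
Proof. by rewrite /poly_comb size_poly0 big_ord0. Qed.

(** Dividing a nontrivial relation by its leading coefficient would express its last [e n] through
    the earlier ones modulo [W]. *)
Lemma poly_comb_free W e :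
  linear_subspace W ->
  (forall n (c : nat -> K), ~ W (e n - \sum_(i < n) c i *: e i)) ->
  forall p, W (poly_comb e p) -> p = 0.
Proof.
move=> lW he p; case: (eqVneq p 0) => // p0.
have szp : size p = (size p).-1.+1 by rewrite prednK // size_poly_gt0.
rewrite (@poly_combE _ (size p).-1.+1) -?szp // szp big_ord_recr /= => Wp.
have lp0 : p`_(size p).-1 != 0 by rewrite -lead_coefE lead_coef_eq0.
case: (he (size p).-1 (fun i => - (p`_(size p).-1)^-1 * p`_i)).
have := subspaceZ (p`_(size p).-1)^-1 lW Wp; congr (W _).
rewrite scalerDr scalerA mulVf // scale1r addrC; congr (_ + _).
rewrite scaler_sumr -sumrN; apply: eq_bigr => i _.
by rewrite mulNr scaleNr opprK scalerA.
Qed.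

(** The sequence is built by recursion on the list of the vectors already chosen: this list does not
    span [U] modulo [W], so another vector can be added. *)
Lemma exists_free_sequence U W :
  (forall n (e : 'I_n -> V), ~ quotient_spanning U W e) ->
  exists e : nat -> V, (forall n, U (e n)) /\
    forall n (c : nat -> K), ~ W (e n - \sum_(i < n) c i *: e i).
Proof.
move=> nspan.
(* The guard on [s] lets [g] be total, with the junk value 0 on lists that leave [U]. *)
have /choice[g gP] : forall s : seq V, exists x, (forall i, (i < size s)%N -> U s`_i) ->
    U x /\ forall c : nat -> K, ~ W (x - \sum_(i < size s) c i *: s`_i).
  move=> s; have [Us|] := pselect (forall i, (i < size s)%N -> U s`_i); last first.
    by exists 0.
  have /not_andP[[]|] := nspan (size s) (fun i => s`_i).
    by move=> i; exact: Us.
  move=> /existsNP[x /not_implyP[Ux nx]]; exists x => _; split=> // c Wc.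
  by apply: nx; exists (fun i => c i).
pose l := fix l n := if n is m.+1 then rcons (l m) (g (l m)) else [::].
have szl n : size (l n) = n by elim: n => //= n; rewrite size_rcons => ->.
have lE n i : (i < n)%N -> (l n)`_i = g (l i).
  elim: n => //= n IHn; rewrite ltnS leq_eqVlt nth_rcons szl => /orP[/eqP->|lin].
    by rewrite ltnn eqxx.
  by rewrite lin IHn.
have Ug n : U (g (l n)).
  elim/ltn_ind: n => n IHn; apply: (gP _ _).1 => i; rewrite szl => lin.
  by rewrite lE //; exact: IHn.
exists (fun n => g (l n)); split=> // n c.
have [|_ /(_ c)] := gP (l n); first by move=> i; rewrite szl => ?; rewrite lE.
rewrite szl; under eq_bigr do rewrite lE //.
by [].
Qed.

(* If [e] were a sequence of vectors independent modulo [W], the nested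
   varieties [e 0 + ... + e (n - 1) + S n], with [S n] the span of [W] and of
   the [e i], [n <= i], would have empty intersection: a common point would be
   a finite combination of the [e i] modulo [W] all of whose coefficients
   are 1. *)
Lemma linearly_compact_quotient U W :
  linear_subspace U -> linearly_compact U ->
  linear_subspace W -> nbhs (0 : V) W -> W `<=` U ->
  exists n (e : 'I_n -> V), quotient_spanning U W e.
Proof.
move=> lU cU lW W0 WU; apply: contrapT => /forallNP nspan.
have [|e [Ue he]] := @exists_free_sequence U W.
  by move=> n f sf; apply: (nspan n); exists f.
have UL p : U (poly_comb e p).
  by apply: subspace_sum => // i _; exact: subspaceZ.
pose S n : set V :=
  [set x | exists2 p : {poly K}, forall i, (i < n)%N -> p`_i = 0 & W (x - poly_comb e p)].
pose v n := poly_comb e (\poly_(i < n) 1).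
have lS n : linear_subspace (S n).
  apply: linear_subspaceP.
    exists 0; first by move=> i _; rewrite coef0.
    by rewrite poly_comb0 subr0; exact: subspace0.
  move=> a x y [p p0 Wp] [q q0 Wq]; exists (a *: p + q).
    by move=> i lin; rewrite coefD coefZ p0 // q0 // mulr0 addr0.
  rewrite poly_combP opprD addrACA -scalerBr; exact: subspaceZD.
have WS n : W `<=` S n.
  move=> x Wx; exists 0; first by move=> i _; rewrite coef0.
  by rewrite poly_comb0 subr0.
have SU n : S n `<=` U.
  move=> x [p _ /WU Up]; rewrite -(subrK (poly_comb e p) x).
  exact: subspaceD.
pose F : set (set V) := range (fun n => coset (v n) (S n)).
have [|G GF|x xF] := cU F.
- move=> _ [n _ <-]; exists (v n), (S n); split=> //; first exact: UL.
  apply: closed_subspaceW; apply: closed_of_nbhs0_subspace => //.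
  exact: filterS (WS n) W0.
- have /choice[idx idxP] : forall H : set V, exists n, F H -> coset (v n) (S n) = H.
    move=> H; have [[n _ nH]|nF] := pselect (F H); first by exists n.
    by exists 0.
  (* The varieties are nested, so the centre of the one with the largest index lies in all those of
     the finite subfamily. *)
  exists (v (\max_(H <- finmap.enum_fset G) idx H)) => H HG /=.
  have FH : F H by apply/set_mem/GF.
  rewrite -(idxP H FH); set N := \max_(_ <- _) _.
  have leN : (idx H <= N)%N by exact: leq_bigmax_seq.
  exists (v N - v (idx H)); last by rewrite addrC subrK.
  exists (\poly_(i < N) 1 - \poly_(i < idx H) 1).
    by move=> i lti; rewrite coefB !coef_poly lti (leq_trans lti leN) subrr.
  by rewrite poly_combB subrr; exact: subspace0.
have [|w [p _ Wp] vwx] := xF (coset (v 0) (S 0)); first by exists 0.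
(* The index is just large enough to compare coefficients in degree [size p]: those of [p] and [q]
   are 0 there, while that of [v (size p).+1] is 1. *)
have [|w' [q q0 Wq] vwx'] := xF (coset (v (size p).+1) (S (size p).+1)).
  by exists (size p).+1.
have pq0 : p - \poly_(i < (size p).+1) 1 - q = 0.
  apply: (poly_comb_free lW he); rewrite !poly_combB.
  have := subspaceB lW Wq Wp; congr (W _).
  have -> : w = x by rewrite -vwx /v poly_def big_ord0 poly_comb0 add0r.
  rewrite -vwx' /v opprB addrC -!addrA; congr (_ + _).
  by rewrite opprD -!addrA addKr.
have := coef0 K (size p); rewrite -pq0 !coefB coef_poly ltnSn nth_default // q0 //.
by rewrite subr0 sub0r => /eqP; rewrite oppr_eq0 oner_eq0.
Qed.

(** The hypotheses say that [phi] induces a surjection of [A / B] onto [A' / B'], and a surjection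
    carries spanning families to spanning families. *)
Lemma quotient_spanning_map (phi : {linear V -> V}) A B A' B' n (e : 'I_n -> V) :
  (forall x, A x -> A' (phi x)) ->
  (forall x, A' x -> exists2 y, A y & B' (x - phi y)) ->
  (forall x, B x -> B' (phi x)) -> linear_subspace B' ->
  quotient_spanning A B e -> quotient_spanning A' B' (phi \o e).
Proof.
move=> AA' A'A BB' lB' [Ae se]; split=> [i|x /A'A[y Ay By]]; first exact: AA'.
have [c Bc] := se y Ay; exists c.
have /= := subspaceD lB' By (BB' _ Bc); congr (B' _).
rewrite linearB /= addrA subrK linear_sum; congr (_ - _).
by apply: eq_bigr => i _; rewrite linearZ.
Qed.

End FiniteDimensionModOpen.

(** * Trajectories and their successive quotients *)

Section Trajectory.
Context {K : fieldType} {V : discreteTvsType K} (phi : {linear V -> V}).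
Context (U : set V) (lU : linear_subspace U).
Local Notation T := (trajectory phi U).

Lemma trajectory0 x : T 0 x <-> x = 0.
Proof.
split=> [[u _ <-]|->]; first by rewrite big_ord0.
by exists (fun=> 0); [move=> i; exact: subspace0|rewrite big_ord0].
Qed.

(** Splitting off the term of index 0, not the last one, lets [phi] factor out of the remaining
    sum. *)
Lemma trajectoryS n x :
  T n.+1 x <-> exists u y, [/\ U u, T n y & x = u + phi y].
Proof.
split=> [[u Uu <-]|[u0 [_ [Uu0 [u Uu <-] ->]]]].
  exists (u ord0), (\sum_(i < n) iter i phi (u (lift ord0 i))); split=> //.
    by exists (fun i => u (lift ord0 i)) => // i; exact: Uu.
  rewrite big_ord_recl linear_sum; congr (_ + _).
exists (fun i => if unlift ord0 i is Some j then u j else u0).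
  by move=> i; case: unliftP.
rewrite big_ord_recl unlift_none linear_sum; congr (_ + _).
by apply: eq_bigr => i _; rewrite liftK.
Qed.

Lemma trajectory_subspace n : linear_subspace (T n).
Proof.
elim: n => [|n IHn]; apply: linear_subspaceP.
- exact/trajectory0.
- move=> a x y /trajectory0-> /trajectory0->; apply/trajectory0.
  by rewrite scaler0 addr0.
- apply/trajectoryS; exists 0, 0; split; [exact: subspace0..|].
  by rewrite linear0 addr0.
- move=> a _ _ /trajectoryS[u [x [Uu Tx ->]]] /trajectoryS[w [y [Uw Ty ->]]].
  apply/trajectoryS; exists (a *: u + w), (a *: x + y).
  by split; [exact: subspaceZD..|rewrite linearP scalerDr addrACA].
Qed.

Lemma trajectory_sub n : T n `<=` T n.+1.
Proof.
elim: n => [x /trajectory0->|n IHn x /trajectoryS[u [y [Uu Ty ->]]]].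
  by apply: subspace0; exact: trajectory_subspace.
by apply/trajectoryS; exists u, y; split => //; exact: IHn.
Qed.

Lemma trajectory1 : T 1 = U.
Proof.
apply/seteqP; split=> [x /trajectoryS[u [y [Uu /trajectory0-> ->]]]|x Ux].
  by rewrite linear0 addr0.
apply/trajectoryS; exists x, 0; split=> //; first exact/trajectory0.
by rewrite linear0 addr0.
Qed.

Lemma trajectory_ge n : U `<=` T n.+1.
Proof.
elim: n => [|n IHn] x Ux; first by rewrite trajectory1.
by apply: trajectory_sub; exact: IHn.
Qed.

Lemma trajectory_map n x : T n x -> T n.+1 (phi x).
Proof.
move=> Tx; apply/trajectoryS; exists 0, x; split=> //; first exact: subspace0.
by rewrite add0r.
Qed.

Lemma trajectory_mod n x : T n.+1 x -> exists2 y, T n y & U (x - phi y).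
Proof. by move=> /trajectoryS[u [y [Uu Ty ->]]]; exists y => //; rewrite addrK. Qed.

Lemma trajectory_spanning n m (e : 'I_m -> V) :
  quotient_spanning (T n.+1) (T n) e ->
  quotient_spanning (T n.+2) (T n.+1) (phi \o e).
Proof.
apply: quotient_spanning_map => [x||x|]; try exact: trajectory_map.
  move=> x /trajectory_mod[y Ty Uy]; exists y => //; exact: trajectory_ge.
exact: trajectory_subspace.
Qed.

(** The indices start at [T 2] modulo [T 1], because [T 1] modulo [T 0] is [U] itself, which may be
    infinite-dimensional. *)
Lemma trajectory_quotient_spanning n :
  continuous phi -> open U -> linearly_compact U ->
  exists m (e : 'I_m -> V), quotient_spanning (T n.+2) (T n.+1) e.
Proof.
move=> phi_cont oU cU; elim: n => [|n [m [e se]]]; last first.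
  by exists m, (phi \o e); exact: trajectory_spanning.
have U0 : nbhs (0 : V) U by apply: open_nbhs_nbhs; split=> //; exact: subspace0.
(* Continuity of [phi] at 0 makes this intersection a neighbourhood of 0, and [phi] maps it into
   [U], that is [T 1]. *)
have [//|//||||m [e se]] := @linearly_compact_quotient _ _ U (U `&` phi @^-1` U).
- by apply: setI_subspace => //; exact: preimage_subspace.
- by apply: filterI => //; apply: phi_cont; rewrite linear0.
- by move=> x [].
exists m, (phi \o e); apply: quotient_spanning_map se => [x Ux|x|x [_ //]|].
- by apply: trajectory_map; rewrite trajectory1.
- by rewrite trajectory1 => /trajectory_mod[y]; rewrite trajectory1; exists y.
- by rewrite trajectory1.
- exact: trajectory_subspace.
Qed.

End Trajectory.

(** * Stationary sequences of natural numbers and their means *)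

Lemma nonincreasing_nat_stationary (b : nat -> nat) :
  (forall k, (b k.+1 <= b k)%N) ->
  exists N, forall k, (N <= k)%N -> b k = b N.
Proof.
move=> bS.
have bnoninc i j : (i <= j)%N -> (b j <= b i)%N.
  by move=> /subnK <-; elim: (j - i)%N => // k; apply: leq_trans; exact: bS.
have Pb : exists m, `[< exists k, b k = m >] by exists (b 0); apply/asboolP; exists 0.
(* [N] is an index at which the least value of [b] is attained. *)
have [_ /asboolP[N <-] minN] := ex_minnP Pb.
exists N => k Nk; apply/eqP; rewrite eqn_leq bnoninc //=.
by apply: minN; apply/asboolP; exists k.
Qed.

Lemma cvg_mean_eventually_const (R : realType) (b : nat -> nat) N :
  (forall k, (N <= k)%N -> b k = b N) ->
  (k.+1%:R^-1 * (\sum_(i < k) b i)%:R : R) @[k --> \oo] --> ((b N)%:R : R).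
Proof.
(* From [N] on, the partial sum exceeds [k.+1 * b N] by this fixed amount, so the mean differs from
   [b N] by [c / k.+1]. *)
move=> bN; pose c : R := (\sum_(i < N) b i)%:R - N.+1%:R * (b N)%:R.
have bE k : (N <= k)%N ->
    k.+1%:R^-1 * (\sum_(i < k) b i)%:R = (b N)%:R + harmonic k * c :> R.
  move=> Nk; suff -> : (\sum_(i < k) b i)%:R = k.+1%:R * (b N)%:R + c :> R.
    by rewrite mulrDr mulKf // pnatr_eq0.
  rewrite /c; elim: k Nk => [|k IHk].
    by rewrite leqn0 => /eqP->; rewrite addrCA subrr addr0.
  rewrite leq_eqVlt => /orP[/eqP<-|Nk]; first by rewrite addrCA subrr addr0.
  rewrite big_ord_recr /= natrD IHk // bN //.
  by rewrite -[k.+2]addn1 natrD mulrDl mul1r addrAC.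
rewrite -[X in _ --> X]addr0 -[X in _ + X](mul0r c).
apply: (@cvg_trans _ ((fun k => (b N)%:R + harmonic k * c) @ \oo)).
  by apply: near_eq_cvg; near=> k; rewrite bE //; near: k; exact: nbhs_infty_ge.
apply: cvgD; first exact: cvg_cst.
apply: cvgMr_tmp; exact: cvg_harmonic.
Unshelve. all: by end_near. Qed.

Theorem proposition3p1 (R : realType) (K : fieldType) (V : discreteTvsType K)
    (phi : {linear V -> V}) (U : set V)
    (V_llc : locally_linearly_compact V)
    (phi_cont : continuous phi)
    (U_B : lc_open_subspaces U) :
  exists alpha : nat -> nat,
    (forall n, (0 < n)%N ->
       quotient_dim R (trajectory phi U n.+1) (trajectory phi U n)
         = (alpha n)%:R%:E) /\
    exists a : nat,
      [/\ \forall n \near \oo, alpha n = a,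
          entropy_seq R phi U @ \oo --> (a%:R%:E : \bar R) &
          algebraic_entropy R phi U = a%:R%:E].
Proof.
have [lU oU cU] := U_B.
have lT := @trajectory_subspace _ _ phi U lU.
(* [b k] is the dimension written [alpha (k + 1)] in the final statement. *)
have /choice[b bP] : forall k, exists m, exists e : 'I_m -> V,
    quotient_basis (trajectory phi U k.+2) (trajectory phi U k.+1) e.
  move=> k; have [m [e se]] := trajectory_quotient_spanning lU k phi_cont oU cU.
  by have [m' _ be] := quotient_basis_of_spanning (lT _) (lT _) se; exists m'.
(* The [phi]-images of a basis of size [b k] span the next quotient, where a free family of size
   [b k.+1] lives. *)
have b_noninc k : (b k.+1 <= b k)%N.
  have [e /quotient_basisP-/(_ (lT _) (lT _))[se _]] := bP k.
  have [f /quotient_basisP-/(_ (lT _) (lT _))[[Af _] ff]] := bP k.+1.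
  exact: quotient_free_leq (lT _) (trajectory_spanning lU se) Af ff.
have dimU k : quotient_dim R (trajectory phi U k.+1) U = (\sum_(i < k) b i)%:R%:E.
  suff [e be] : exists e : 'I_(\sum_(i < k) b i) -> V,
      quotient_basis (trajectory phi U k.+1) U e.
    exact: quotient_dim_basis be.
  (* Bases of the successive quotients are concatenated along the chain from [U] to [T k.+1]; for
     [k = 0] the empty family is a basis. *)
  elim: k => [|k [e be]].
    rewrite big_ord0 trajectory1 //; exists (fun=> 0); apply/quotient_basisP => //.
    split; last by move=> c _ [].
    split=> [[]//|x Ux]; exists (fun=> 0).
    by rewrite big_ord0 subr0.
  have [f bf] := bP k; rewrite big_ord_recr /=.
  apply: quotient_basis_cat be bf => //; first exact: trajectory_sub.
  exact: trajectory_ge.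
have [N bN] := nonincreasing_nat_stationary b_noninc.
have cvgH : entropy_seq R phi U @ \oo --> ((b N)%:R%:E : \bar R).
  (* The shift skips the term at 0 and matches the factor [k.+1^-1] with a sum of only [k]
     dimensions. *)
  rewrite -cvg_shiftS.
  have -> : (fun n => entropy_seq R phi U n.+1) =
      EFin \o (fun k => k.+1%:R^-1 * (\sum_(i < k) b i)%:R).
    by apply/funext => k; rewrite /entropy_seq dimU.
  apply: cvg_EFin; first exact: nearW.
  exact: cvg_mean_eventually_const.
(* The value at [n = 0] is arbitrary; the shift by one also turns the threshold [N] into [N.+1]. *)
exists (fun n => b n.-1); split=> [[//|k] _|].
  by have [e be] := bP k; exact: quotient_dim_basis be.
exists (b N); split=> //.
  exists N.+1 => // n /= Nn; apply: bN.
  by rewrite -ltnS (ltn_predK Nn).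
exact/cvg_lim/cvgH/ereal_hausdorff.
Qed.
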